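(* Let $G$ be a finite simple connected graph with $\omega(G)\ge 2$ that contains no induced subgraph isomorphic to $P_5$ or to $K_{2,3}$. Then $\chi(G)\le 2\omega^2(G)-\omega(G)-3$.
   Context: $P_5$ is the path on 5 vertices, $K_{2,3}$ the complete bipartite graph with parts of sizes 2 and 3; $\chi$ is the chromatic number and $\omega$ the clique number. *)

(* Defs.v *)
From mathcomp Require Import all_boot.

Set Implicit Arguments.
Unset Strict Implicit.
Unset Printing Implicit Defensive.

Record sgraph := SGraph {
  vertex :> finType;
  adj : rel vertex;
  adj_sym : symmetric adj;
  adj_irr : irreflexive adj }.

Section Induced.
Variables (G : sgraph) (A : {set G}).

Definition induced_adj : rel {x : G | x \in A} :=
  fun x y => adj (val x) (val y).

Lemma induced_adj_sym : symmetric induced_adj.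
Proof. by move=> x y; apply: adj_sym. Qed.

Lemma induced_adj_irr : irreflexive induced_adj.
Proof. by move=> x; apply: adj_irr. Qed.

Definition induced : sgraph := SGraph induced_adj_sym induced_adj_irr.

End Induced.

Definition isomorphic (G H : sgraph) : Prop :=
  exists f : G -> H,
    bijective f /\ (forall x y : G, adj (f x) (f y) = adj x y).

Definition induced_free (H G : sgraph) : Prop :=
  ~ exists A : {set G}, isomorphic (induced A) H.

Definition path_adj (n : nat) : rel 'I_n :=
  fun i j => (i.+1 == j :> nat) || (j.+1 == i :> nat).

Lemma path_adj_sym n : symmetric (@path_adj n).
Proof. by move=> i j; rewrite /path_adj orbC. Qed.

Lemma path_adj_irr n : irreflexive (@path_adj n).
Proof. by move=> i; rewrite /path_adj orbb gtn_eqF. Qed.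

(* n counts vertices, not edges. *)
Definition path_graph (n : nat) : sgraph :=
  SGraph (@path_adj_sym n) (@path_adj_irr n).

Definition bip_adj (m n : nat) : rel ('I_m + 'I_n)%type :=
  fun x y => match x, y with
             | inl _, inr _ | inr _, inl _ => true
             | _, _ => false
             end.

Lemma bip_adj_sym m n : symmetric (@bip_adj m n).
Proof. by case=> i; case=> j. Qed.

Lemma bip_adj_irr m n : irreflexive (@bip_adj m n).
Proof. by case. Qed.

Definition complete_bipartite (m n : nat) : sgraph :=
  SGraph (@bip_adj_sym m n) (@bip_adj_irr m n).

Definition connected (G : sgraph) : Prop :=
  0 < #|G| /\ forall x y : G, connect (@adj G) x y.

Definition is_clique (G : sgraph) (A : {set G}) : bool :=
  [forall x in A, forall y in A, (x != y) ==> adj x y].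

Definition clique_number (G : sgraph) : nat :=
  \max_(A : {set G} | is_clique A) #|A|.

Definition colorable (G : sgraph) (k : nat) : bool :=
  [exists c : {ffun G -> 'I_k}, forall x, forall y, adj x y ==> (c x != c y)].

Lemma ex_colorable (G : sgraph) : exists k, colorable G k.
Proof.
exists #|G|; apply/existsP; exists [ffun x => enum_rank x].
apply/forallP=> x; apply/forallP=> y; apply/implyP=> xy; rewrite !ffunE.
by apply: contraTneq xy => /enum_rank_inj->; rewrite adj_irr.
Qed.

Definition chromatic_number (G : sgraph) : nat := ex_minn (ex_colorable G).

(* Main.v *)
(**
Let [w] be the clique number. In a minimal counterexample no clique is a cutset.
The common neighbourhood of two nonadjacent vertices has no independent triple and
clique number less than [w], hence is [C(w, 2)]-colourable.

Without an induced pentagon, the traces of two nonadjacent neighbours of a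
vertex [v] on a component of the nonneighbours of [v] are nested and meet in a
clique. Peeling off such cliques shows that the nonneighbours of [v] are
[w]-colourable, and the bound follows by induction applied to the neighbours.

Around an induced pentagon [v1 ... v5], a vertex with a neighbour on it either is a
twin of some [vi] or sees two vertices of the pentagon at distance two from a third
one which it also sees. Twins of consecutive vertices are completely joined, which
forces two consecutive twin classes to be cliques; these take [w] colours
altogether, and three common neighbourhoods cover the rest with [3 C(w, 2)]
colours. A component [D] not touching the pentagon is not attached to twins.
Since its boundary is not a clique, [D] is either a clique, coloured like the
two twin classes, or a join of two sets without independent triples, attached to
few colours.
*)

Require Import Defs.
From mathcomp Require Import all_boot zify.

Set Implicit Arguments.
Unset Strict Implicit.
Unset Printing Implicit Defensive.

(** * Colourings of vertex sets: components, palettes and gluing *)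

Section Coloring.
Variable G : sgraph.
Implicit Types (A B D K M S : {set G}) (x y z u v : G) (c : G -> nat).

Lemma cliqueP A :
  reflect {in A &, forall x y, x != y -> adj x y} (is_clique A).
Proof.
apply: (iffP forall_inP) => [h x y xA yA | h x xA].
  by move/forall_inP: (h x xA) => /(_ y yA)/implyP.
by apply/forall_inP => y yA; apply/implyP; apply: h.
Qed.

Definition omega_le A w := forall K, K \subset A -> is_clique K -> #|K| <= w.

Definition proper_on A c := {in A &, forall x y, adj x y -> c x != c y}.

Definition colorable_in A k :=
  exists2 c, {in A, forall x, c x < k} & proper_on A c.

Definition nbrs v : {set G} := [set x | adj v x].

Definition boundary D : {set G} :=
  [set x | (x \notin D) && [exists y in D, adj x y]].

Definition no_triad A := forall x y z, x \in A -> y \in A -> z \in A ->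
  x != y -> x != z -> y != z -> [|| adj x y, adj x z | adj y z].

(** Connectedness in cut form: it directly yields an edge across which a property changes, which is
    how induced paths are found below. *)
Definition linked D := forall (S : pred G) x y, x \in D -> y \in D ->
  S x -> ~~ S y -> exists s t, [/\ s \in D, t \in D, adj s t, S s & ~~ S t].

Definition component M D := [/\ D \subset M, D != set0, linked D &
  forall x y, x \in D -> y \in M -> adj x y -> y \in D].

Definition compatible B c D (d : G -> nat) :=
  forall x y, x \in B -> y \in D -> adj x y -> c x != d y.

Lemma boundaryP D x :
  reflect (x \notin D /\ exists2 y, y \in D & adj x y) (x \in boundary D).
Proof.
rewrite inE; apply: (iffP andP) => -[xD h]; split=> //.
  by case/exists_inP: h => y; exists y.
by case: h => y yD xy; apply/exists_inP; exists y.
Qed.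

Lemma sub_clique A B : A \subset B -> is_clique B -> is_clique A.
Proof.
move=> /subsetP sAB /cliqueP h; apply/cliqueP => x y xA yA.
by apply: h; apply: sAB.
Qed.

Lemma not_clique A : ~~ is_clique A ->
  exists x y, [/\ x \in A, y \in A, x != y & ~~ adj x y].
Proof.
rewrite negb_forall_in => /exists_inP[x xA].
rewrite negb_forall_in => /exists_inP[y yA].
by rewrite negb_imply => /andP[xy nxy]; exists x, y.
Qed.

Lemma clique1 x : is_clique [set x].
Proof.
by apply/cliqueP => y z; rewrite !inE => /eqP-> /eqP->; rewrite eqxx.
Qed.

Lemma cliqueU A B : is_clique A -> is_clique B ->
  (forall x y, x \in A -> y \in B -> x != y -> adj x y) -> is_clique (A :|: B).
Proof.
move=> /cliqueP hA /cliqueP hB hAB; apply/cliqueP => x y.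
rewrite !inE => /orP[xA|xB] /orP[yA|yB] xy; [exact: hA| exact: hAB | |exact: hB].
by rewrite adj_sym; apply: hAB => //; rewrite eq_sym.
Qed.

Lemma omega_sub A B w : A \subset B -> omega_le B w -> omega_le A w.
Proof. by move=> sAB h K sKA; apply: h; apply: subset_trans sAB. Qed.

Lemma omega_nbrs A v w : A \subset nbrs v -> omega_le setT w.+1 -> omega_le A w.
Proof.
move=> /subsetP sA h K sKA cK.
have vK : v \notin K.
  by apply/negP => /(subsetP sKA)/sA; rewrite inE adj_irr.
suff : is_clique (v |: K).
  by move=> /(h _ (subsetT _)); rewrite cardsU1 vK.
apply: cliqueU => //.
  exact: clique1.
by move=> x y; rewrite inE => /eqP-> /(subsetP sKA)/sA; rewrite inE.
Qed.

Lemma component_mem M x : x \in M ->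
  component M [set y | connect [rel a b | [&& a \in M, b \in M & adj a b]] x y].
Proof.
move=> xM; set e := [rel a b | _].
have eC : connect_sym e.
  by apply: sym_connect_sym => a b /=; rewrite adj_sym andbCA.
split.
- apply/subsetP => y; rewrite inE => /connectP[p + ->].
  elim: p x xM => //= a p IH x xM /andP[/and3P[_ aM _]]; exact: IH.
- by apply/set0Pn; exists x; rewrite inE connect0.
- move=> S a b; rewrite !inE => xa xb Sa nSb.
  have /connectP[p ep eb] : connect e a b by apply: (connect_trans _ xb); rewrite eC.
  elim: p a xa Sa ep eb => /= [|d p IH] a xa Sa.
    by move=> _ E; rewrite E Sa in nSb.
  move=> /andP[ead ep] eb; have xd : connect e x d.
    exact: connect_trans xa (@connect1 _ e a d ead).
  case: (boolP (S d)) => Sd; first exact: (IH d).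
  by exists a, d; split; rewrite ?inE //; case/and3P: ead.
- move=> a b; rewrite !inE => xa bM ab.
  apply: (connect_trans (xa)); apply: connect1; rewrite /= ab bM !andbT.
  case/connectP: (xa) => p ep -> {xa}.
  elim: p x xM ep => //= d p IH x xM /andP[/and3P[_ dM _]]; exact: IH.
Qed.

(** Different components of [M] are joined by no edge, so colourings chosen separately on them fit
    together. *)
Lemma color_components B c M k :
  (forall D, component M D -> exists d,
     [/\ {in D, forall x, d x < k}, proper_on D d & compatible B c D d]) ->
  exists d, [/\ {in M, forall x, d x < k}, proper_on M d & compatible B c M d].
Proof.
move=> h.
pose e := [rel a b | [&& a \in M, b \in M & adj a b]].
(* A choice is made at every vertex, with a dummy colouring off [M]; only the choices at component
   roots are used. *)
have hx x : exists d, x \in M -> [/\ {in [set y | connect e x y], forall x, d x < k},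
    proper_on [set y | connect e x y] d & compatible B c [set y | connect e x y] d].
  case: (boolP (x \in M)) => [xM|_]; last by exists (fun=> 0).
  by have [d hd] := h _ (component_mem xM); exists d.
have {hx}[f hf] := fin_all_exists hx.
pose r := root e.
have eC : connect_sym e.
  by apply: sym_connect_sym => a b /=; rewrite adj_sym andbCA.
have rM x : x \in M -> r x \in M /\ x \in [set y | connect e (r x) y].
  move=> xM; have := connect_root e x; rewrite -/(r x) => xr.
  split; last by rewrite inE eC.
  by have [/subsetP s _ _ _] := component_mem xM; apply: s; rewrite inE.
exists (fun x => f (r x) x); split.
- by move=> x /rM[rx xr]; have [] := hf _ rx => + _ _; apply.
- move=> x y xM yM xy.
  have -> : r y = r x.
    by apply/eqP; rewrite eq_sym /r root_connect //; apply: connect1; rewrite /= xM yM.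
  have [rx xr] := rM _ xM; have [_ + _] := hf _ rx; apply=> //.
  have [_ _ _] := component_mem rx; apply; first exact: xr.
    exact: yM.
  exact: xy.
- by move=> x y xB /rM[ry yr] xy; have [_ _] := hf _ ry; apply.
Qed.

Lemma colorable_in_sub A B k : A \subset B -> colorable_in B k -> colorable_in A k.
Proof.
move=> /subsetP s [c cb cp]; exists c; first by move=> x /s; apply: cb.
by move=> x y /s xB /s; apply: cp.
Qed.

Lemma colorable_in_le A k k' : k <= k' -> colorable_in A k -> colorable_in A k'.
Proof. by move=> le [c cb cp]; exists c => // x /cb /leq_trans; apply. Qed.

Lemma color_palette A k (L : seq nat) : uniq L -> k <= size L ->
  colorable_in A k -> exists2 c, {in A, forall x, c x \in L} & proper_on A c.
Proof.
move=> uL kL [c cb cp]; exists (fun x => nth 0 L (c x)).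
  by move=> x /cb h; rewrite mem_nth // (leq_trans h).
by move=> x y xA yA xy; rewrite nth_uniq ?cp // (leq_trans (cb _ _)).
Qed.

Lemma clique_palette A (L : seq nat) : uniq L -> #|A| <= size L ->
  exists2 c, {in A, forall x, c x \in L} & {in A &, injective c}.
Proof.
move=> uL kL; exists (fun x => nth 0 L (index x (enum A))).
  move=> x xA; rewrite mem_nth // (leq_trans _ kL) // cardE index_mem.
  by rewrite mem_enum.
have hA x : x \in A -> index x (enum A) < size L.
  by move=> xA; rewrite (leq_trans _ kL) // cardE index_mem mem_enum.
move=> x y xA yA /eqP; rewrite nth_uniq ?hA // => /eqP.
by apply: (index_inj x); rewrite mem_enum.
Qed.

Lemma colorable_card A k : #|A| <= k -> colorable_in A k.
Proof.
move=> Ak; have [|c cb ci] := @clique_palette A (iota 0 k) (iota_uniq _ _).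
  by rewrite size_iota.
exists c => [x /cb|x y xA yA xy]; first by rewrite mem_iota.
by apply: contraTneq xy => /ci -> //; rewrite adj_irr.
Qed.

(** The explicit formula is kept because [pentagon_colorable] has to know which block of colours
    each piece receives. *)
Lemma proper_stack A B c d a : {in A, forall x, c x < a} ->
  proper_on A c -> proper_on B d ->
  proper_on (A :|: B) (fun x => if x \in A then c x else a + d x).
Proof.
move=> cb cp dp x y; rewrite !inE.
case: ifP => [xA _|_ /= xB]; case: ifP => [yA _|_ /= yB] xy.
- exact: cp.
- by rewrite ltn_eqF // (leq_trans (cb _ xA)) ?leq_addr.
- by rewrite gtn_eqF // (leq_trans (cb _ yA)) ?leq_addr.
- by rewrite eqn_add2l dp.
Qed.

Lemma colorable_inU A B a b :
  colorable_in A a -> colorable_in B b -> colorable_in (A :|: B) (a + b).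
Proof.
move=> [c cb cp] [d db dp]; exists (fun x => if x \in A then c x else a + d x).
  move=> x; rewrite inE; case: ifP => [xA _|_ /= xB].
    by rewrite (leq_trans (cb _ xA)) ?leq_addr.
  by rewrite ltn_add2l db.
exact: proper_stack.
Qed.

Lemma omega1_colorable A : omega_le A 1 -> colorable_in A 1.
Proof.
move=> om; exists (fun=> 0) => // x y xA yA xy.
have neq : x != y by apply: contraTneq xy => ->; rewrite adj_irr.
have : #|[set x; y]| <= 1; last by rewrite cards2 neq.
apply: om; first by apply/subsetP => z; rewrite !inE => /orP[]/eqP->.
apply/cliqueP => a b; rewrite !inE.
by move=> /orP[]/eqP-> /orP[]/eqP->; rewrite ?eqxx // adj_sym.
Qed.

Lemma colorable_add v A k : 0 < k -> (forall x, x \in A -> ~~ adj v x) ->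
  colorable_in A k -> colorable_in (v |: A) k.
Proof.
move=> k0 vA [c cb cp]; exists (fun x => if x == v then 0 else c x).
  by move=> x; rewrite !inE; case: eqP => //= _ /cb.
move=> x y; rewrite !inE.
case: (eqVneq x v) => [->|_] /=; case: (eqVneq y v) => [->|_] //=.
- by rewrite adj_irr.
- by move=> _ /vA/negPf->.
- by move=> + _; rewrite adj_sym => /vA/negPf->.
- exact: cp.
Qed.

(** In the induction step to [k.+1], pick [v] in [A]. Its nonneighbours in [A] form a clique, so
    they and [v] share [k.+1] colours; its neighbours in [A] have clique number at most [k], and
    ['C(k.+2, 2) = 'C(k.+1, 2) + k.+1]. *)
Lemma no_triad_colorable A k :
  no_triad A -> omega_le A k -> colorable_in A 'C(k.+1, 2).
Proof.
elim: k A => [|k IH] A nt om.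
  apply: colorable_card; rewrite leqn0; apply: contraT; rewrite -lt0n => /card_gt0P[x xA].
  suff: #|[set x]| <= 0 by rewrite cards1.
  apply: om; first by rewrite sub1set.
  exact: clique1.
have [->|/set0Pn[v vA]] := eqVneq A set0.
  by apply: colorable_card; rewrite cards0.
pose Z := [set x in A | (x != v) && ~~ adj v x].
have sA : A \subset (A :&: nbrs v) :|: (v |: Z).
  by apply/subsetP => x xA; rewrite !inE xA; case: eqP => //= _; rewrite ?orbT ?orbN.
apply: (colorable_in_sub sA).
rewrite binS bin1 addnC [X in colorable_in _ X]addnC; apply: colorable_inU.
  apply: IH.
    by move=> x y z /setIP[xA _] /setIP[yA _] /setIP[zA _]; apply: nt.
  move=> K sK cK.
  have vK : v \notin K.
    by apply/negP => /(subsetP sK); rewrite !inE adj_irr andbF.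
  suff : #|v |: K| <= k.+1 by rewrite cardsU1 vK.
  apply: om.
    rewrite subUset sub1set vA /=; apply: subset_trans sK _; exact: subsetIl.
  apply: cliqueU => //.
    exact: clique1.
  by move=> a b; rewrite !inE => /eqP-> /(subsetP sK); rewrite !inE => /andP[].
apply: colorable_add => //.
  by move=> x; rewrite inE => /and3P[].
apply: colorable_card; apply: om; first by apply/subsetP => x; rewrite inE => /andP[].
apply/cliqueP => x y; rewrite !inE => /and3P[xA xv vx] /and3P[yA yv vy] xy.
move: (nt v x y vA xA yA); rewrite ![v == _]eq_sym xv yv xy.
by move=> /(_ isT isT isT); rewrite (negPf vx) (negPf vy).
Qed.

(* The second colouring is permuted so as to agree with the first on the
   clique, where both are injective. *)
Lemma glue_clique D k : is_clique (boundary D) ->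
  colorable_in (~: D) k -> colorable_in (D :|: boundary D) k ->
  colorable_in setT k.
Proof.
set C := boundary D => /cliqueP cC [c cb cp] [d db dp].
have cD x : x \in C -> x \in ~: D by move=> /boundaryP[]; rewrite inE.
have dD x : x \in C -> x \in D :|: C by move=> xC; rewrite in_setU xC orbT.
have inj (f : G -> nat) B : {subset C <= B} -> proper_on B f -> {in C &, injective f}.
  move=> sB fp x y xC yC E; apply/eqP; apply: contraT => xy.
  by have := fp x y (sB _ xC) (sB _ yC) (cC _ _ xC yC xy); rewrite E eqxx.
(* [ext f] lists the colours on [C] in the order of [enum C], then all others. Matching positions in
   [ext d] and [ext c] is the permutation [s], which sends [d x] to [c x] on [C]. *)
pose ext (f : G -> nat) := [seq f x | x <- enum C] ++
  [seq i <- iota 0 k | i \notin [seq f x | x <- enum C]].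
have uniq_ext f : {in C &, injective f} -> uniq (ext f).
  move=> fi; rewrite cat_uniq filter_uniq ?iota_uniq // andbT map_inj_in_uniq.
    by rewrite enum_uniq; apply/hasPn => i; rewrite mem_filter => /andP[].
  by move=> x y; rewrite !mem_enum; apply: fi.
have perm_ext f : {in C &, injective f} -> {in C, forall x, f x < k} ->
    perm_eq (ext f) (iota 0 k).
  move=> fi fb; apply: uniq_perm; rewrite ?iota_uniq ?uniq_ext // => i.
  rewrite mem_cat mem_filter; case: (boolP (i \in map _ _)) => //=.
  by move=> /mapP[x]; rewrite mem_enum mem_iota => xC ->; rewrite fb.
have ci := inj c _ cD cp; have di := inj d _ dD dp.
have pc := perm_ext c ci (fun x xC => cb x (cD x xC)).
have pd := perm_ext d di (fun x xC => db x (dD x xC)).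
pose s i := nth 0 (ext c) (index i (ext d)).
have dk i : i < k -> index i (ext d) < size (ext c).
  by move=> ik; rewrite (perm_size pc) -(perm_size pd) index_mem (perm_mem pd) mem_iota.
have sk i : i < k -> s i < k.
  by move=> ik; have := mem_nth 0 (dk i ik); rewrite (perm_mem pc) mem_iota.
have si i j : i < k -> j < k -> s i = s j -> i = j.
  move=> ik jk /eqP; rewrite nth_uniq ?dk ?uniq_ext // => /eqP.
  by apply: (index_inj 0); rewrite (perm_mem pd) mem_iota.
have sdc x : x \in C -> s (d x) = c x.
  move=> xC; rewrite /s /ext index_cat map_f ?mem_enum // nth_cat size_map.
  rewrite -(size_map d) index_mem map_f ?mem_enum // (nth_map x); last first.
    by rewrite -(size_map d) index_mem map_f ?mem_enum.
  by rewrite nth_index_map ?mem_enum // => a b; rewrite !mem_enum; apply: di.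
have DC x : x \in D -> x \in D :|: C by move=> xD; rewrite in_setU xD.
exists (fun x => if x \in D then s (d x) else c x).
  move=> x _; case: ifPn => xD; first by rewrite sk // db // DC.
  by rewrite cb // inE.
have cross x y : x \in D -> y \notin D -> adj x y -> s (d x) != c y.
  move=> xD yD xy; have yC : y \in C.
    by apply/boundaryP; split=> //; exists x; rewrite // adj_sym.
  rewrite -sdc //; apply/eqP => /si E.
  by have /eqP := dp x y (DC _ xD) (dD _ yC) xy; apply; apply: E; apply: db; auto.
move=> x y _ _ xy; case: ifPn => xD; case: ifPn => yD.
- apply/eqP => /si E; have /eqP := dp x y (DC _ xD) (DC _ yD) xy.
  by apply; apply: E; apply: db; auto.
- exact: cross.
- by rewrite eq_sym; apply: cross; rewrite // adj_sym.
- by apply: cp; rewrite ?inE.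
Qed.

End Coloring.

(** These ten conditions already force the five vertices to be distinct. *)
Definition no_P5 (G : sgraph) := forall a b c d e : G,
  adj a b -> adj b c -> adj c d -> adj d e ->
  ~~ adj a c -> ~~ adj a d -> ~~ adj a e ->
  ~~ adj b d -> ~~ adj b e -> ~~ adj c e -> False.

(** An independent triple among the common neighbours would be the part of size three of an induced
    [K_{2,3}]. *)
Definition no_K23 (G : sgraph) := forall a b : G,
  a != b -> ~~ adj a b -> no_triad (nbrs a :&: nbrs b).

Definition pentagon (G : sgraph) (a b c d e : G) :=
  [&& adj a b, adj b c, adj c d, adj d e & adj e a] &&
  [&& ~~ adj a c, ~~ adj a d, ~~ adj b d, ~~ adj b e & ~~ adj c e].

Ltac adj_solve := solve [assumption | rewrite adj_sym; assumption].

(** Two nonadjacent vertices of this set would form with [z] an independent triple among the common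
    neighbours of [a] and [b]. *)
Lemma common_nbrs_clique (G : sgraph) (a b z : G) (D : {set G}) :
  no_K23 G -> a != b -> ~~ adj a b -> adj a z -> adj b z ->
  z \notin D -> {in D, forall x, ~~ adj z x} ->
  is_clique (D :&: nbrs a :&: nbrs b).
Proof.
move=> hK ab nab az bz zD zx; apply/cliqueP => x y.
rewrite !inE => /andP[/andP[xD ax] bx] /andP[/andP[yD ay] bY] xy.
have neq t : t \in D -> z != t by move=> tD; apply: contraNneq zD => ->.
have := hK a b ab nab z x y; rewrite !inE az bz ax bx ay bY.
move=> /(_ isT isT isT (neq _ xD) (neq _ yD) xy).
by rewrite (negPf (zx _ xD)) (negPf (zx _ yD)).
Qed.

Lemma size_avoid (L S : seq nat) : uniq L ->
  size L <= size [seq i <- L | i \notin S] + size S.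
Proof.
move=> uL; rewrite -(count_predC (mem S) L) addnC size_filter leq_add2l.
rewrite -size_filter; apply: uniq_leq_size; first exact: filter_uniq.
by move=> i; rewrite mem_filter => /andP[].
Qed.

(** * Without an induced pentagon: the nonneighbours of a vertex *)

Section PentagonFree.
Variable G : sgraph.
Hypotheses (hP : no_P5 G) (hK : no_K23 G).
Hypothesis hC : forall a b c d e : G, ~~ pentagon a b c d e.
Variable v : G.
Implicit Types (D K Q : {set G}) (b x y z : G).

Let M : {set G} := ~: (v |: nbrs v).
Hypothesis no_cutset :
  forall D, D != set0 -> D \subset M -> ~~ is_clique (boundary D).

Lemma nonnbr_far D x : D \subset M -> x \in D -> ~~ adj v x.
Proof. by move=> /subsetP s /s; rewrite !inE negb_or => /andP[]. Qed.

(** Otherwise there are [s] and [t] in [D], the first seen only by [b] and the second only by [b'].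
    If they are adjacent, [v b s t b'] is an induced pentagon; if not, [s b v b' t] is an induced
    path. *)
Lemma traces_nested D b b' : D \subset M -> adj v b -> adj v b' ->
  b != b' -> ~~ adj b b' ->
  D :&: nbrs b \subset nbrs b' \/ D :&: nbrs b' \subset nbrs b.
Proof.
move=> sD vb vb' bb' nbb'.
have step p q x y : adj v p -> adj v q -> ~~ adj p q ->
    x \in D -> y \in D -> adj x y -> adj p x -> ~~ adj p y -> adj q x.
  move=> vp vq npq /(nonnbr_far sD) vx /(nonnbr_far sD) vy xy px py; apply: contraT => qx.
  case: (boolP (adj q y)) => qy.
    have /negP := hC v p x y q; case; rewrite /pentagon vp px xy npq.
    by rewrite adj_sym qy adj_sym vq vx vy py adj_sym qx.
  by case: (hP (a := q) (b := v) (c := p) (d := x) (e := y)); adj_solve.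
apply/orP; apply: contraT; rewrite negb_or => /andP[].
move=> /subsetPn[s]; rewrite !inE => /andP[sD' bs] nb's.
move=> /subsetPn[t]; rewrite !inE => /andP[tD' b't] nbt.
have vs := nonnbr_far sD sD'; have vt := nonnbr_far sD tD'.
have nst : ~~ adj s t.
  apply/negP => st; move/negP: nb's; apply.
  exact: (step b b' s t).
by case: (hP (a := s) (b := b) (c := v) (d := b') (e := t)); adj_solve.
Qed.

(* [Q] collects the cliques removed so far: a component of what remains is
   completely joined to the part of [Q] that it sees, so each removed clique
   vertex costs one unit of clique number. *)
Lemma trace_induction D Q m : linked D -> D != set0 -> D \subset M ->
  boundary D \subset nbrs v :|: Q -> is_clique Q ->
  (forall q x, q \in Q -> x \in D -> adj q x) ->
  (forall q, q \in Q -> exists p, [/\ adj v p, adj p q,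
     {in D, forall x, ~~ adj p x} & forall b, adj v b ->
     (exists2 x, x \in D & adj b x) -> b != p -> ~~ adj b p -> adj b q]) ->
  omega_le D m -> colorable_in D m.
Proof.
have [n leDn] := ubnP #|D|.
elim: n D Q m leDn => // n IH D Q m leDn lD D0 sDM bD cQ QD wQ om.
(* Take [p] and [q] nonadjacent in the boundary. If both are neighbours of [v], the smaller of their
   nested traces consists of common neighbours, and [v] makes it a clique. If [q] is in [Q], its
   witness [r] replaces [v], and the whole trace of [p] is a clique because [q] sees all of [D]. *)
have [b [vb b0 cK]] : exists b, [/\ adj v b, D :&: nbrs b != set0 &
    is_clique (D :&: nbrs b)].
  have vD : v \notin D by apply/negP => /(subsetP sDM); rewrite !inE eqxx.
  have trace p : p \in boundary D -> D :&: nbrs p != set0.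
    by case/boundaryP => _ [x xD px]; apply/set0Pn; exists x; rewrite !inE xD.
  have mixed p q : p \in boundary D -> adj v p -> q \in Q -> p != q -> ~~ adj p q ->
      is_clique (D :&: nbrs p).
    move=> pD vp qQ pq npq.
    have [r [vr rq rD h]] := wQ q qQ.
    case/boundaryP: (pD) => npD [x xD px].
    have pr : p != r by apply: contraNneq (rD x xD) => <-.
    have apr : adj p r.
      by apply: contraT => npr; rewrite (h p vp) in npq => //; exists x.
    have rnD : r \notin D by apply/negP => /(nonnbr_far sDM); rewrite vr.
    have := common_nbrs_clique hK pq npq apr _ rnD rD; rewrite adj_sym.
    move=> /(_ rq); apply: sub_clique; apply/subsetP => y.
    by rewrite !inE => /andP[yD ->]; rewrite yD QD.
  have [p [q [pD qD pq npq]]] := not_clique (no_cutset D0 sDM).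
  have := subsetP bD p pD; have := subsetP bD q qD; rewrite !inE.
  case: (boolP (adj v q)) => [vq _|_ /= qQ]; last first.
    case: (boolP (adj v p)) => [vp _|_ /= pQ].
      by exists p; split; [|exact: trace|exact: (mixed p q)].
    by move/cliqueP: cQ => /(_ p q pQ qQ pq); rewrite (negPf npq).
  case: (boolP (adj v p)) => [vp _|_ /= pQ]; last first.
    exists q; split; [done|exact: trace|].
    by apply: (mixed q p) => //; rewrite 1?eq_sym 1?adj_sym.
  have cl : is_clique (D :&: nbrs p :&: nbrs q).
    apply: (common_nbrs_clique hK pq npq (z := v)); rewrite // 1?adj_sym //.
    by move=> x; apply: nonnbr_far.
  case: (traces_nested sDM vp vq pq npq) => sub.
    exists p; split; [done|exact: trace|].
    by move: cl; rewrite (setIidPl sub).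
  exists q; split; [done|exact: trace|].
  by move: cl; rewrite -setIA [nbrs p :&: _]setIC setIA (setIidPl sub).
set K := D :&: nbrs b in b0 cK.
have sKD : K \subset D by exact: subsetIl.
have bx x : x \in D -> (x \in K) = adj b x by move=> xD; rewrite !inE xD.
have [|c cb ci] := @clique_palette _ K (iota 0 m) (iota_uniq _ _).
  by rewrite size_iota; apply: om.
have cp : proper_on K c.
  by move=> x y xK yK xy; apply: contraTneq xy => /ci -> //; rewrite adj_irr.
(* [K] keeps its injective colouring, and each component of [D :\: K] is coloured around it. *)
suff [d [db dp dc]] : exists d, [/\ {in D :\: K, forall x, d x < m},
    proper_on (D :\: K) d & compatible K c (D :\: K) d].
  have split_D x : x \in D -> x \notin K -> x \in D :\: K.
    by move=> xD xK; rewrite in_setD xK.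
  exists (fun x => if x \in K then c x else d x).
    move=> x xD; case: ifPn => xK; last by apply: db; apply: split_D.
    by have := cb x xK; rewrite mem_iota.
  move=> x y xD yD xy; case: ifPn => xK; case: ifPn => yK.
  - exact: cp.
  - by apply: dc; rewrite ?split_D.
  - by rewrite eq_sym; apply: dc; rewrite ?split_D // adj_sym.
  - by apply: dp; rewrite ?split_D.
apply: color_components => D' [sD' D'0 lD' cD'].
pose K' := K :&: boundary D'.
have sub x : x \in D' -> x \in D /\ ~~ adj b x.
  by move=> /(subsetP sD'); rewrite in_setD => /andP[xK xD]; rewrite -bx.
have sD'D : D' \subset D by apply/subsetP => x /sub[].
have sD'M := subset_trans sD'D sDM.
(* If [x] saw only part of [D'], an edge [s t] of [D'] with only [s] seen by [x] would give the
   induced path [v b x s t]. *)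
have K'D x y : x \in K' -> y \in D' -> adj x y.
  rewrite in_setI => /andP[xK /boundaryP[xD' [z zD' xz]]] yD'.
  apply: contraT => nxy.
  have [s [t [sD'' tD'' st xs nxt]]] := lD' (adj x) z y zD' yD' xz nxy.
  have [_ nbs] := sub _ sD''; have [_ nbt] := sub _ tD''.
  have xD := subsetP sKD _ xK; rewrite bx // in xK.
  have vx := nonnbr_far sDM xD; have vs := nonnbr_far sD'M sD''.
  have vt := nonnbr_far sD'M tD''.
  by case: (hP (a := v) (b := b) (c := x) (d := s) (e := t)); adj_solve.
have sK'K : K' \subset K by exact: subsetIl.
have sK'D := subset_trans sK'K sKD.
have cK' := sub_clique sK'K cK.
have disj x : x \in K' -> x \notin D'.
  by move=> /(subsetP sK'K) xK; apply/negP => /(subsetP sD'); rewrite in_setD xK.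
have om' : omega_le D' (m - #|K'|).
  move=> X sX cX; suff : #|X :|: K'| <= m.
    rewrite cardsU (_ : X :&: K' = set0) ?cards0 ?subn0.
      by move=> h; rewrite leq_subRL ?(leq_trans _ h) ?leq_addl // addnC.
    apply/setP => x; rewrite in_setI in_set0; apply/negP => /andP[xX /disj].
    by rewrite (subsetP sX).
  apply: om; first by rewrite subUset (subset_trans sX sD'D).
  apply: cliqueU => // x y xX yK _; rewrite adj_sym.
  by apply: K'D => //; apply: subsetP xX.
have ltD' : #|D'| < n.
  rewrite -ltnS; apply: leq_trans leDn; rewrite ltnS; apply: proper_card.
  rewrite properE sD'D; case/set0Pn: b0 => x xK; apply/subsetPn; exists x.
    exact: subsetP xK.
  by apply/negP => /(subsetP sD'); rewrite in_setD xK.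
have /color_palette pal : colorable_in D' (m - #|K'|).
  apply: (IH D' (Q :|: K')) => //.
  - apply/subsetP => x /boundaryP[xD' [y yD' xy]].
    rewrite !in_setU in_setI; case: (boolP (x \in D)) => xD.
      case: (boolP (x \in K)) => xK.
        by rewrite (_ : x \in boundary D') ?orbT //; apply/boundaryP; split=> //; exists y.
      case/negP: xD'; apply: (cD' y x) => //; first by rewrite in_setD xK.
      by rewrite adj_sym.
    rewrite orbA -in_setU (subsetP bD) //; apply/boundaryP; split=> //.
    by exists y => //; apply: subsetP yD'.
  - by apply: cliqueU => // x y xQ /(subsetP sK'D) yD _; apply: QD.
  - move=> q x; rewrite in_setU => /orP[qQ /(subsetP sD'D)|qK]; first exact: QD.
    exact: K'D.
  - move=> q; rewrite in_setU => /orP[qQ|qK].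
      have [p [vp pq pD h]] := wQ q qQ; exists p; split=> //.
        by move=> x /(subsetP sD'D); apply: pD.
      move=> b' vb' [x xD' b'x]; apply: h => //; exists x => //.
      exact: subsetP xD'.
    (* The witness of a newly removed vertex [q] is [b]: a neighbour [b'] of [v] nonadjacent to [b]
       and meeting [D'] has a trace not inside that of [b], hence containing it, so [b'] sees
       [q]. *)
    have qK0 := subsetP sK'K _ qK; have qD := subsetP sKD _ qK0.
    exists b; split=> //; first by rewrite -bx.
      by move=> x /sub[].
    move=> b' vb' [x xD' b'x] b'b nb'b; have [xD nbx] := sub _ xD'.
    case: (traces_nested sDM vb' vb b'b nb'b) => /subsetP h.
      by have := h x; rewrite !inE xD b'x (negPf nbx) => /(_ isT).
    by have := h q qK0; rewrite inE.
(* Among the vertices of [K] only those of [K'] have neighbours in [D'], and at least [m - #|K'|]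
   colours avoid theirs. *)
pose L := [seq i <- iota 0 m | i \notin [seq c x | x <- enum K']].
have := @pal L; case.
- by rewrite filter_uniq ?iota_uniq.
- have := size_avoid [seq c x | x <- enum K'] (iota_uniq 0 m).
  by rewrite size_iota size_map -cardE -/L leq_subLR addnC.
move=> d db dp; exists d; split=> //.
  by move=> x /db; rewrite mem_filter mem_iota => /andP[].
move=> x y xK yD' xy; have /db := yD'; rewrite mem_filter => /andP[h _].
apply: contraNneq h => <-; apply: map_f; rewrite mem_enum in_setI xK.
apply/boundaryP; split; last by exists y.
by apply/negP => /(subsetP sD'); rewrite in_setD xK.
Qed.

(** The trace induction starts with [Q] empty, since a component of [M] is bounded by neighbours of
    [v] only. *)
Lemma nonnbrs_colorable m : omega_le M m -> colorable_in M m.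
Proof.
move=> om; have [|d [db dp _]] := @color_components G set0 (fun=> 0) M m.
  move=> D [sDM D0 lD cD].
  have [d db dp] : colorable_in D m; last first.
    by exists d; split=> // x y; rewrite inE.
  apply: (@trace_induction D set0) => //.
  - apply/subsetP => x /boundaryP[xD [y yD xy]]; rewrite setU0 inE.
    apply: contraT => vx; case/negP: xD; apply: (cD y) => //.
      rewrite !inE negb_or vx andbT; apply: contraNneq (nonnbr_far sDM yD) => <-.
      exact: xy.
    by rewrite adj_sym.
  - by apply/cliqueP => x y; rewrite inE.
  - by move=> q x; rewrite inE.
  - by move=> q; rewrite inE.
  - exact: omega_sub om.
by exists d.
Qed.

End PentagonFree.

(** * Around an induced pentagon: twins and dense vertices *)

Section Pentagon.
Variable G : sgraph.
Hypotheses (hP : no_P5 G) (hK : no_K23 G).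
Implicit Types (D K : {set G}) (a b c d e u x y z : G).

(** On a pentagon [a b c d e], the class of twins of [a] is [twins e b c d]. Adjacency to [a] is
    left open, so that [a] belongs to its own class. *)
Definition twins a b c d : {set G} :=
  [set x | [&& adj x a, adj x b, ~~ adj x c & ~~ adj x d]].

Lemma pentagon_rot a b c d e : pentagon a b c d e -> pentagon b c d e a.
Proof.
rewrite /pentagon => /andP[/and5P[-> -> -> -> ->] /and5P[]].
by rewrite [adj a c]adj_sym [adj a d]adj_sym => -> -> -> -> ->.
Qed.

(** Otherwise [x e d c y] is an induced path. *)
Lemma consecutive_twins_adj a b c d e x y : pentagon a b c d e ->
  x \in twins e b c d -> y \in twins a c d e -> adj x y.
Proof.
move=> /andP[/and5P[ab bc cd de ea] /and5P[nac nad nbd nbe nce]].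
rewrite !inE => /and4P[xe xb xc xd] /and4P[ya yc yd ye].
apply: contraT => nxy.
by case: (hP (a := x) (b := e) (c := d) (d := c) (e := y)); adj_solve.
Qed.

(** Nonadjacent twins [x], [x'] of [a] and nonadjacent twins [y], [y'] of [b] would give an induced
    [K_{2,3}] with parts [x], [x'] and [e], [y], [y']. *)
Lemma consecutive_twins_clique a b c d e : pentagon a b c d e ->
  is_clique (twins e b c d) || is_clique (twins a c d e).
Proof.
move=> pent; apply: contraT; rewrite negb_or => /andP[].
move=> /not_clique[x [x' [xA x'A xx' nxx']]].
move=> /not_clique[y [y' [yA y'A yy' nyy']]].
have h z : z \in twins a c d e -> adj x z && adj x' z.
  by move=> zA; rewrite !(consecutive_twins_adj pent).
have := hK xx' nxx' (x := e) (y := y) (z := y').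
have /andP[xy x'y] := h y yA; have /andP[xy' x'y'] := h y' y'A.
move: xA x'A; rewrite !inE => /and4P[xe _ _ _] /and4P[x'e _ _ _].
rewrite xy x'y xy' x'y' xe x'e (negPf nyy') yy'.
case/andP: pent => _ /and5P[_ _ _ _ nce].
have ne z : z \in twins a c d e -> (e != z) && ~~ adj e z.
  rewrite inE => /and4P[_ zc _ ze]; rewrite adj_sym ze andbT.
  by apply: contraNneq nce => ->; rewrite adj_sym.
have /andP[-> /negPf->] := ne y yA; have /andP[-> /negPf->] := ne y' y'A.
by move=> /(_ isT isT isT isT isT isT).
Qed.

(** Otherwise [x u b c d] is an induced path. *)
Lemma twins_far a b c d e u x : pentagon a b c d e -> u \in twins e b c d ->
  ~~ has (adj x) [:: a; b; c; d; e] -> ~~ adj u x.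
Proof.
move=> /andP[/and5P[ab bc cd de ea] /and5P[nac nad nbd nbe nce]].
rewrite inE => /and4P[ue ub uc ud]; rewrite /= !negb_or andbT.
move=> /and5P[xa xb xc xd xe]; apply/negP => ux.
by case: (hP (a := x) (b := u) (c := b) (d := c) (e := d)); adj_solve.
Qed.

Variables v1 v2 v3 v4 v5 : G.
Hypothesis pent : pentagon v1 v2 v3 v4 v5.
Let C := [:: v1; v2; v3; v4; v5].
Let M : {set G} := [set x | ~~ has (adj x) C].
Hypothesis no_cutset :
  forall D, D != set0 -> D \subset M -> ~~ is_clique (boundary D).

(** Each disjunct is a pentagon vertex together with the two ends of the opposite edge. *)
Definition dense x :=
  [|| [&& adj x v1, adj x v3 & adj x v4], [&& adj x v2, adj x v4 & adj x v5],
      [&& adj x v3, adj x v5 & adj x v1], [&& adj x v4, adj x v1 & adj x v2] |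
      [&& adj x v5, adj x v2 & adj x v3]].

Definition any_twin : {set G} := twins v5 v2 v3 v4 :|: twins v1 v3 v4 v5 :|:
  twins v2 v4 v5 v1 :|: twins v3 v5 v1 v2 :|: twins v4 v1 v2 v3.

Lemma far_pentagon D x y : D \subset M -> x \in D -> y \in C -> ~~ adj y x.
Proof.
move=> /subsetP s /s; rewrite inE => h yC; apply: contraNN h => yx.
by apply/hasP; exists y; rewrite // adj_sym.
Qed.

Lemma pentagon_out D y : D \subset M -> y \in C -> y \notin D.
Proof.
case/andP: pent => /and5P[ab bc cd de ea] _ /subsetP s yC; apply/negP => /s.
rewrite inE => /negP; apply; move: yC; rewrite /C !inE => /or4P[|||/orP[]]/eqP->.
- by rewrite /= ab orbT.
- by rewrite /= bc !orbT.
- by rewrite /= cd !orbT.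
- by rewrite /= de !orbT.
- by rewrite /= ea.
Qed.

(** If the neighbours of [x] on the pentagon are a single vertex or two adjacent ones, an induced
    path runs from [x] through four consecutive pentagon vertices. Every other nonempty trace is of
    one of the two kinds. *)
Lemma touching x : has (adj x) C -> dense x || (x \in any_twin).
Proof.
case/andP: pent => /and5P[ab bc cd de ea] /and5P[nac nad nbd nbe nce].
rewrite /dense !inE /= orbF.
case: (boolP (adj x v1)) => E1; case: (boolP (adj x v2)) => E2;
  case: (boolP (adj x v3)) => E3; case: (boolP (adj x v4)) => E4;
  case: (boolP (adj x v5)) => E5 => //= _; exfalso;
  solve [ case: (hP (a := x) (b := v1) (c := v2) (d := v3) (e := v4)); adj_solve
        | case: (hP (a := x) (b := v2) (c := v3) (d := v4) (e := v5)); adj_solve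
        | case: (hP (a := x) (b := v3) (c := v4) (d := v5) (e := v1)); adj_solve
        | case: (hP (a := x) (b := v4) (c := v5) (d := v1) (e := v2)); adj_solve
        | case: (hP (a := x) (b := v5) (c := v1) (d := v2) (e := v3)); adj_solve ].
Qed.

Lemma any_twin_far u x : u \in any_twin -> ~~ has (adj x) C -> ~~ adj u x.
Proof.
have p2 := pentagon_rot pent; have p3 := pentagon_rot p2.
have p4 := pentagon_rot p3; have p5 := pentagon_rot p4.
move=> + nx; have nxr n : ~~ has (adj x) (rot n C) by rewrite has_rot.
rewrite !in_setU => /orP[/orP[/orP[/orP[]|]|]|] uA.
- exact: twins_far pent uA nx.
- exact: twins_far p2 uA (nxr 1).
- exact: twins_far p3 uA (nxr 2).
- exact: twins_far p4 uA (nxr 3).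
- exact: twins_far p5 uA (nxr 4).
Qed.

(** Each of the two sees at least three of the five pentagon vertices. *)
Lemma dense_meet u u' : dense u -> dense u' ->
  exists2 p, p \in C & adj u p && adj u' p.
Proof.
move=> du du'; apply/hasP; move: du du'; rewrite /dense /=.
case: (adj u v1); case: (adj u v2); case: (adj u v3); case: (adj u v4);
  case: (adj u v5) => //= _;
  case: (adj u' v1); case: (adj u' v2); case: (adj u' v3); case: (adj u' v4);
  by case: (adj u' v5).
Qed.

Lemma dense_pair u : dense u -> exists p q,
  [/\ p \in C, q \in C, p != q, ~~ adj p q & adj u p && adj u q].
Proof.
case/andP: pent => /and5P[ab bc cd de ea] /and5P[nac nad nbd nbe nce].
have n13 : v1 != v3 by apply: contraNneq nad => ->.
have n14 : v1 != v4 by apply: contraNneq nac => ->; rewrite adj_sym.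
have n24 : v2 != v4 by apply: contraNneq nbe => ->.
have n35 : v3 != v5 by apply: contraNneq nbe => <-.
have n25 : v2 != v5 by apply: contraNneq nbd => ->; rewrite adj_sym.
rewrite /C => /or4P[|||/orP[]] /and3P[h1 h2 h3].
- by exists v1, v3; rewrite !inE !eqxx ?orbT h1 h2.
- by exists v2, v4; rewrite !inE !eqxx ?orbT h1 h2.
- by exists v3, v5; rewrite !inE !eqxx ?orbT h1 h2.
- by exists v1, v4; rewrite !inE !eqxx ?orbT h1 h2.
- by exists v2, v5; rewrite !inE !eqxx ?orbT h1 h2.
Qed.

Lemma dense_partial u : dense u -> ~~ all (adj u) C ->
  exists p q, [/\ p \in C, q \in C, adj p q, adj u p & ~~ adj u q].
Proof.
case/andP: pent => /and5P[ab bc cd de ea] _; rewrite /dense /= /C.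
case: (boolP (adj u v1)) => E1; case: (boolP (adj u v2)) => E2;
  case: (boolP (adj u v3)) => E3; case: (boolP (adj u v4)) => E4;
  case: (boolP (adj u v5)) => E5 => //= _ _;
  solve [ by exists v1, v2; rewrite !inE !eqxx ?orbT
        | by exists v2, v3; rewrite !inE !eqxx ?orbT
        | by exists v3, v4; rewrite !inE !eqxx ?orbT
        | by exists v4, v5; rewrite !inE !eqxx ?orbT
        | by exists v5, v1; rewrite !inE !eqxx ?orbT ].
Qed.

(** * Components without neighbours on the pentagon *)

Section OuterComponent.
Variable D : {set G}.
Hypothesis compD : component M D.

Lemma boundary_dense u : u \in boundary D -> dense u.
Proof.
have [sDM D0 lD cD] := compD; case/boundaryP => uD [y yD uy].
have yM := subsetP sDM y yD; rewrite inE in yM.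
have : has (adj u) C.
  apply: contraNT uD => hu; apply: (cD y) => //; first by rewrite inE.
  by rewrite adj_sym.
case/touching/orP => // /any_twin_far/(_ yM); by rewrite uy.
Qed.

(** Otherwise an edge [s t] of [D] and an edge [p q] of the pentagon, of which [u] sees only [s] and
    only [p], give the induced path [t s u p q]. *)
Lemma partial_complete u : u \in boundary D -> ~~ all (adj u) C ->
  {in D, forall x, adj u x}.
Proof.
move=> uB nfull y yD; have [sDM D0 lD cD] := compD.
have [p [q [pC qC pq up nuq]]] := dense_partial (boundary_dense uB) nfull.
case/boundaryP: uB => uD [z zD uz]; apply: contraT => nuy.
have [s [t [sD tD st us nut]]] := lD (adj u) z y zD yD uz nuy.
have := far_pentagon sDM sD pC; have := far_pentagon sDM sD qC.
have := far_pentagon sDM tD pC; have := far_pentagon sDM tD qC.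
move=> qt pt qs ps.
by case: (hP (a := t) (b := s) (c := u) (d := p) (e := q)); adj_solve.
Qed.

Hypothesis nclD : ~~ is_clique D.

(** A common neighbour in [D] and two nonadjacent pentagon vertices seen by both would be an
    independent triple; this settles the cases where [u] or [u'] sees the whole pentagon. If neither
    does, both are complete to [D] and share a pentagon neighbour, so [D] would be a clique. *)
Lemma boundary_nonadj u u' : u \in boundary D -> u' \in boundary D ->
  u != u' -> ~~ adj u u' -> [/\ all (adj u) C, all (adj u') C &
  {in D, forall x, adj u x -> ~~ adj u' x}].
Proof.
have [sDM D0 lD cD] := compD.
have no_common p p' x : p \in boundary D -> p != p' -> ~~ adj p p' ->
    all (adj p') C -> x \in D -> adj p x -> ~~ adj p' x.
  move=> pB pp' npp' fp' xD px; apply/negP => p'x.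
  have [q [r [qC rC qr nqr /andP[pq pr]]]] := dense_pair (boundary_dense pB).
  have nx z : z \in C -> (x != z) && ~~ adj x z.
    move=> zC; rewrite adj_sym (far_pentagon sDM xD zC) andbT.
    by apply: contraTneq xD => ->; apply: pentagon_out.
  have := hK pp' npp' (x := x) (y := q) (z := r).
  rewrite !inE px p'x pq pr !(allP fp') // qr (negPf nqr).
  have /andP[-> /negPf->] := nx _ qC; have /andP[-> /negPf->] := nx _ rC.
  by move=> /(_ isT isT isT isT isT isT).
move=> uB u'B uu' nuu'.
have u'u : u' != u by rewrite eq_sym.
have nu'u : ~~ adj u' u by rewrite adj_sym.
have nbr p : p \in boundary D -> exists2 x, x \in D & adj p x.
  by case/boundaryP.
case: (boolP (all (adj u) C)) => fu; case: (boolP (all (adj u') C)) => fu'.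
- by split=> // x xD ux; apply: (no_common u u').
- have [x xD ux] := nbr u uB; have u'x := partial_complete u'B fu' xD.
  by have := no_common u' u x u'B u'u nu'u fu xD u'x; rewrite ux.
- have [x xD u'x] := nbr u' u'B; have ux := partial_complete uB fu xD.
  by have := no_common u u' x uB uu' nuu' fu' xD ux; rewrite u'x.
have [p pC /andP[up u'p]] := dense_meet (boundary_dense uB) (boundary_dense u'B).
case/negP: nclD.
have pD := pentagon_out sDM pC.
have := common_nbrs_clique hK uu' nuu' up u'p pD.
move=> /(_ (fun x xD => far_pentagon sDM xD pC)); apply: sub_clique.
by apply/subsetP => x xD; rewrite !inE xD !partial_complete.
Qed.

(** Nonadjacent boundary vertices see the whole pentagon, so they lie in the removed set. *)
Lemma outer_boundary_clique : is_clique (boundary D :\: (nbrs v5 :&: nbrs v2)).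
Proof.
apply/cliqueP => x y; rewrite !in_setD => /andP[xP xB] /andP[_ yB] xy.
apply: contraT => nxy; have [/allP h _ _] := boundary_nonadj xB yB xy nxy.
by case/negP: xP; rewrite !inE ![adj _ x]adj_sym !h /C ?inE ?eqxx ?orbT.
Qed.

(** Two nonadjacent boundary vertices split [D] into their traces. Each trace is complete to the
    other: for [y] in the trace of [p'], the trace of [p] consists of common neighbours of the
    nonadjacent vertices [p] and [y]. *)
Lemma outer_colorable w : omega_le [set: G] w.+1 ->
  colorable_in D ('C(w.+1, 2) + 'C(w.+1, 2)).
Proof.
move=> om; have [sDM D0 lD cD] := compD.
have [u [u' [uB u'B uu' nuu']]] := not_clique (no_cutset D0 sDM).
have u'u : u' != u by rewrite eq_sym.
have nu'u : ~~ adj u' u by rewrite adj_sym.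
have [fu fu' disj] := boundary_nonadj uB u'B uu' nuu'.
have [_ _ disj'] := boundary_nonadj u'B uB u'u nu'u.
have C1 : v1 \in C by rewrite /C inE eqxx.
(* An edge [s t] of [D] leaving the two traces from that of [u] gives the induced path
   [u' v1 u s t]. *)
have cover : D \subset (D :&: nbrs u) :|: (D :&: nbrs u').
  apply/subsetP => y yD; rewrite !inE yD /=; apply: contraT => nuy.
  case/boundaryP: (uB) => _ [x xD ux].
  have [||s [t [sD tD st]]] := lD [pred z | adj u z || adj u' z] x y xD yD.
  - by rewrite /= ux.
  - exact: nuy.
  rewrite /= negb_or => hs /andP[nut nu't].
  have v1s := far_pentagon sDM sD C1; have v1t := far_pentagon sDM tD C1.
  have uv1 := allP fu v1 C1; have u'v1 := allP fu' v1 C1.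
  case/orP: hs => hs.
    have nu's := disj s sD hs.
    by case: (hP (a := u') (b := v1) (c := u) (d := s) (e := t)); adj_solve.
  have nus := disj' s sD hs.
  by case: (hP (a := u) (b := v1) (c := u') (d := s) (e := t)); adj_solve.
have half p p' : p \in boundary D -> p' \in boundary D -> ~~ adj p p' ->
    all (adj p) C -> all (adj p') C ->
    {in D, forall x, adj p x -> ~~ adj p' x} ->
    {in D, forall x, adj p' x -> ~~ adj p x} ->
    colorable_in (D :&: nbrs p) 'C(w.+1, 2).
  move=> pB p'B npp' fp fp' dis dis'; case/boundaryP: p'B => p'D [y yD p'y].
  case/boundaryP: pB => pD _.
  have pv1 := allP fp v1 C1; have p'v1 := allP fp' v1 C1.
  have npy := dis' y yD p'y; have v1y := far_pentagon sDM yD C1.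
  apply: no_triad_colorable; last first.
    by apply: omega_nbrs om; apply: subsetIr.
  have py : p != y by apply: contraNneq pD => ->.
  suff sub : D :&: nbrs p \subset nbrs p :&: nbrs y.
    by move=> a b c /(subsetP sub) ha /(subsetP sub) hb /(subsetP sub); apply: hK.
  apply/subsetP => x; rewrite !inE => /andP[xD px]; rewrite px /=.
  apply: contraT => nyx; have np'x := dis x xD px.
  have v1x := far_pentagon sDM xD C1.
  by case: (hP (a := x) (b := p) (c := v1) (d := p') (e := y)); adj_solve.
apply: colorable_in_sub cover _; apply: colorable_inU.
  exact: (half u u').
exact: (half u' u).
Qed.

End OuterComponent.

(** * Colouring a graph that has an induced pentagon *)

Lemma dense_cover x : dense x -> x \in nbrs v5 :&: nbrs v2 :|:
  (nbrs v1 :&: nbrs v3 :|: nbrs v2 :&: nbrs v4).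
Proof.
(* Each of the five triples contains one of the nonadjacent pairs [v5 v2], [v1 v3], [v2 v4]. *)
rewrite !inE ![adj _ x]adj_sym => /or4P[|||/orP[]] /and3P[h1 h2 h3].
- by rewrite h1 h2 !orbT.
- by rewrite h1 h3.
- by rewrite h1 h3 !orbT.
- by rewrite h1 h3 !orbT.
- by rewrite h1 h2.
Qed.

(** Consecutive blocks of [q], [q + q] and [w.+1] colours go to [P1], [P2] and the clique [Z] formed
    by the twins of [v4] and [v5]. The components of [M] are then coloured against these, using that
    only dense vertices are attached to them. *)
Lemma pentagon_colorable w : omega_le [set: G] w.+1 ->
  is_clique (twins v3 v5 v1 v2) -> is_clique (twins v4 v1 v2 v3) ->
  colorable_in [set: G] (3 * 'C(w.+1, 2) + w.+1).
Proof.
have sum3 (q k : nat) : q + (q + q + k) = 3 * q + k by lia.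
have lt1 (i q k : nat) : i < q -> i < 3 * q + k by lia.
have lt2 (i q k : nat) : i < q + q -> q + i < 3 * q + k by lia.
move=> om cl4 cl5; set q := 'C(w.+1, 2).
have p4 := pentagon_rot (pentagon_rot (pentagon_rot pent)).
case/andP: (pent) => _ /and5P[n13 n14 n24 n25 n35].
pose P1 := nbrs v5 :&: nbrs v2.
pose P2 := nbrs v1 :&: nbrs v3 :|: nbrs v2 :&: nbrs v4.
pose Z := twins v3 v5 v1 v2 :|: twins v4 v1 v2 v3.
have piece a b : a != b -> ~~ adj a b -> colorable_in (nbrs a :&: nbrs b) q.
  move=> ab nab; apply: no_triad_colorable; first exact: hK.
  by apply: omega_nbrs om; apply: subsetIl.
have [n1 n2 n3] : [/\ v5 != v2, v1 != v3 & v2 != v4].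
  case/andP: pent => /and5P[e12 e23 e34 e45 e51] _; split.
  - by apply: contraNneq n24 => <-; rewrite adj_sym.
  - by apply: contraNneq n14 => ->.
  - by apply: contraNneq n25 => ->.
have [c1 c1b c1p] : colorable_in P1 q by apply: piece; rewrite // adj_sym.
have [c2 c2b c2p] : colorable_in P2 (q + q) by apply: colorable_inU; apply: piece.
have ZP : is_clique Z.
  apply: cliqueU => // x y xA yA _; exact: (consecutive_twins_adj p4).
have [c3 c3b c3p] : colorable_in Z w.+1 by apply: colorable_card; apply: om.
pose c23 x := if x \in P2 then c2 x else q + q + c3 x.
pose c x := if x \in P1 then c1 x else q + c23 x.
have c23p : proper_on (P2 :|: Z) c23 by exact: proper_stack.
have cp : proper_on (P1 :|: (P2 :|: Z)) c by exact: proper_stack.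
(* The twins of [v1], [v2] and [v3] already lie in the three common neighbourhoods. *)
have inB x : x \notin M -> x \in P1 :|: (P2 :|: Z).
  rewrite inE negbK => /touching/orP[/dense_cover|].
    by move=> h; rewrite setUA; apply/setUP; left; exact: h.
  rewrite !inE ![adj _ x]adj_sym.
  move=> /orP[/orP[/orP[/orP[]|]|]|] /and4P[h1 h2 h3 h4];
  by rewrite h1 h2 ?h3 ?h4 ?orbT.
have cb x : x \notin M -> c x < 3 * q + w.+1.
  move=> /inB; rewrite in_setU [x \in P2 :|: Z]in_setU /c /c23; case: ifPn => [/c1b h _|_ /=]; first exact: lt1.
  case: ifPn => [/c2b h _|_ /= /c3b h]; first exact: lt2.
  by rewrite -sum3 !ltn_add2l.
have c_dense x : dense x -> c x < 3 * q.
  move=> /dense_cover; rewrite in_setU /c /c23 -/P1 -/P2.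
  rewrite -[3 * q]addn0; case: ifPn => [/c1b h _|_ /= xP2]; first exact: lt1.
  by rewrite xP2; apply: lt2; apply: c2b.
have [D compD|d [db dp dc]] := @color_components G (~: M) c M (3 * q + w.+1).
  have [sDM D0 lD cD] := compD.
  have bnd x y : x \in ~: M -> y \in D -> adj x y -> x \in boundary D.
    rewrite in_setC => xM yD xy; apply/boundaryP; split; last by exists y.
    by apply: contraNN xM; apply: (subsetP sDM).
  case: (boolP (is_clique D)) => clD.
    (* The boundary of [D] is dense, hence coloured below [3 * q]: the last block is free for the
       clique [D]. *)
    have [|d db di] := @clique_palette G D (iota (3 * q) w.+1) (iota_uniq _ _).
      by rewrite size_iota; apply: om.
    exists d; split.
    - by move=> x /db; rewrite mem_iota => /andP[].
    - by move=> x y xD yD xy; apply: contraTneq xy => /di -> //; rewrite adj_irr.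
    move=> x y xM yD xy; have /(boundary_dense compD)/c_dense h := bnd x y xM yD xy.
    by have := db y yD; rewrite mem_iota => /andP[h' _]; rewrite ltn_eqF // (leq_trans h).
  (* [P1] uses only colours below [q]. The boundary outside [P1] is a clique and blocks at most
     [w.+1] of the other [q + q + w.+1] colours, leaving the [q + q] that [D] needs. *)
  pose S := [seq c x | x <- enum (boundary D :\: P1)].
  have sS : size S <= w.+1.
    by rewrite size_map -cardE; apply: om => //; apply: outer_boundary_clique.
  have uL : uniq (iota q (q + q + w.+1)) by exact: iota_uniq.
  have [||d db dp] := color_palette _ _ (outer_colorable compD clD om)
    (L := [seq i <- iota q (q + q + w.+1) | i \notin S]).
  - exact: filter_uniq.
  - have := size_avoid S uL; rewrite size_iota => h.
    by rewrite -(leq_add2r w.+1); apply: leq_trans h _; rewrite leq_add2l.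
  exists d; split=> //.
    by move=> x /db; rewrite mem_filter mem_iota sum3 => /and3P[].
  move=> x y xM yD xy; have := db y yD; rewrite mem_filter mem_iota => /and3P[nS qd _].
  have xB := bnd x y xM yD xy.
  case: (boolP (x \in P1)) => xP1.
    by rewrite /c xP1 ltn_eqF // (leq_trans (c1b x xP1)).
  apply: contraNneq nS => <-; apply: map_f.
  by rewrite mem_enum in_setD xP1.
exists (fun x => if x \in M then d x else c x).
  by move=> x _; case: ifPn => [/db|/cb].
move=> x y _ _ xy; case: ifPn => xM; case: ifPn => yM.
- exact: dp.
- by rewrite eq_sym; apply: dc; rewrite ?in_setC // adj_sym.
- by apply: dc; rewrite // in_setC.
- by apply: cp => //; apply: inB.
Qed.

(** The general count gives five colours here, two too many. Without triangles no vertex is dense,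
    so nothing is attached to [M], which is therefore empty; all vertices are then twins, and each
    sees one of [v1], [v2], [v3]. *)
Lemma pentagon_colorable3 : omega_le [set: G] 2 -> colorable_in [set: G] 3.
Proof.
move=> om; have one x : colorable_in (nbrs x) 1.
  by apply: omega1_colorable; apply: omega_nbrs om; apply: subxx.
have tri x y z : adj x y -> adj x z -> ~~ adj y z.
  move=> xy xz; have [c cb cp] := one x; apply/negP => yz.
  have := cp y z; rewrite !inE xy xz => /(_ isT isT yz).
  have := cb y; rewrite inE xy ltnS leqn0 => /(_ isT)/eqP->.
  by have := cb z; rewrite inE xz ltnS leqn0 => /(_ isT)/eqP->.
have M0 : M = set0.
  apply/eqP; apply: contraT => /no_cutset/(_ (subxx _))/not_clique[u [_ [+ _ _ _]]].
  case/boundaryP; rewrite inE negbK => /touching/orP[du|ut] [y yM uy]; last first.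
    by rewrite inE in yM; have := any_twin_far ut yM; rewrite uy.
  case/andP: pent => /and5P[ab bc cd de ea] _.
  case/or4P: du => [|||/orP[]] /and3P[h1 h2 h3].
  - by have := tri _ _ _ h2 h3; rewrite cd.
  - by have := tri _ _ _ h2 h3; rewrite de.
  - by have := tri _ _ _ h2 h3; rewrite ea.
  - by have := tri _ _ _ h2 h3; rewrite ab.
  - by have := tri _ _ _ h2 h3; rewrite bc.
suff cover : [set: G] \subset nbrs v1 :|: (nbrs v2 :|: nbrs v3).
  apply: colorable_in_sub cover _; rewrite -[3]/(1 + (1 + 1)).
  by do 2!apply: colorable_inU => //.
apply/subsetP => x _; have : x \notin M by rewrite M0 inE.
rewrite inE negbK => /touching; rewrite /dense !inE ![adj _ x]adj_sym.
by case: (adj x v1); case: (adj x v2); case: (adj x v3); rewrite ?orbT ?andbF.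
Qed.

End Pentagon.

(** At [w = 1] the truncated formula is [0], but one colour is needed, and the induction on
    neighbourhoods reaches this case. *)
Definition chi_bound w := if w <= 1 then w else 2 * w ^ 2 - w - 3.

Lemma chi_boundS w : chi_bound w.+1 + w.+2 <= chi_bound w.+2.
Proof. by case: w => [|w] //; rewrite /chi_bound /=; nia. Qed.

(** With [W = w.+3] the two sides differ by [(W - 3) (W + 2) / 2], so equality holds at clique
    number three. *)
Lemma chi_bound_pentagon w : 3 * 'C(w.+3, 2) + w.+3 <= chi_bound w.+3.
Proof.
have := mul_bin_diag w.+3 1; rewrite bin1 /chi_bound /= => h.
by move: 'C(w.+3, 2) h => q h; nia.
Qed.

(** * Induction over vertex sets *)

Lemma chi_bound_step (G : sgraph) w : no_P5 G -> no_K23 G ->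
  (forall (A : {set G}) w', A \proper [set: G] -> omega_le A w' ->
     colorable_in A (chi_bound w')) ->
  omega_le [set: G] w -> colorable_in [set: G] (chi_bound w).
Proof.
move=> hP hK IH om.
have [G0|/set0Pn[v _]] := eqVneq [set: G] set0.
  by apply: colorable_card; rewrite G0 cards0.
case: w om => [|[|w]] om; last 1 first.
(* A clique boundary leaves two proper subsets, coloured by induction and glued along the clique. *)
- case: (boolP [exists D : {set G}, [&& D != set0, D :|: boundary D != setT &
                  is_clique (boundary D)]]) => [/existsP[D /and3P[D0 DT cl]]|ncut].
    apply: (glue_clique cl); apply: IH; rewrite ?properT //.
    - by apply: contraNneq D0 => /(congr1 (@setC G)); rewrite setCK setCT => ->.
    - exact: omega_sub (subsetT _) om.
    - exact: omega_sub (subsetT _) om.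
  have no_cutset (D : {set G}) x : D != set0 -> x \notin D :|: boundary D ->
      ~~ is_clique (boundary D).
    move=> D0 xD; move: ncut; rewrite negb_exists => /forallP/(_ D).
    rewrite D0 /= negb_and => /orP[|//]; rewrite negbK => /eqP DT.
    by rewrite DT inE in xD.
  case: (boolP [exists t : G * G * G * G * G,
      pentagon t.1.1.1.1 t.1.1.1.2 t.1.1.2 t.1.2 t.2]).
    case/existsP => -[[[[v1 v2] v3] v4] v5] /= pent.
    have cut (a b c d e : G) : pentagon a b c d e -> forall D : {set G}, D != set0 ->
        D \subset [set x | ~~ has (adj x) [:: a; b; c; d; e]] ->
        ~~ is_clique (boundary D).
      move=> p D D0 sD; have aC : a \in [:: a; b; c; d; e] by rewrite inE eqxx.
      apply: (no_cutset D a) => //; rewrite in_setU negb_or.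
      rewrite (pentagon_out p sD aC); apply/negP => /boundaryP[_ [y yD]].
      by apply/negP; apply: far_pentagon sD yD aC.
    case: w om => [|w] om.
      exact: (pentagon_colorable3 hP pent (cut _ _ _ _ _ pent) om).
    apply: colorable_in_le (chi_bound_pentagon w) _.
    have col (a b c d e : G) : pentagon a b c d e -> is_clique (twins c e a b) ->
        is_clique (twins d a b c) -> colorable_in [set: G] (3 * 'C(w.+3, 2) + w.+3).
      by move=> p; apply: (pentagon_colorable hP hK p (cut _ _ _ _ _ p) om).
    have p2 := pentagon_rot pent; have p3 := pentagon_rot p2.
    have p4 := pentagon_rot p3; have p5 := pentagon_rot p4.
    (* Of any two consecutive twin classes one is a clique. As five is odd, some two consecutive
       classes are both cliques, and a rotation moves them to the last two positions. *)
    have := consecutive_twins_clique hP hK pent.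
    have := consecutive_twins_clique hP hK p2.
    have := consecutive_twins_clique hP hK p3.
    have := consecutive_twins_clique hP hK p4.
    have := consecutive_twins_clique hP hK p5.
    have := col _ _ _ _ _ pent; have := col _ _ _ _ _ p2.
    have := col _ _ _ _ _ p3; have := col _ _ _ _ _ p4.
    have := col _ _ _ _ _ p5.
    case: (is_clique (twins v5 v2 v3 v4)); case: (is_clique (twins v1 v3 v4 v5));
    case: (is_clique (twins v2 v4 v5 v1)); case: (is_clique (twins v3 v5 v1 v2));
    by case: (is_clique (twins v4 v1 v2 v3)); auto.
  rewrite negb_exists => /forallP npent.
  have hC (a b c d e : G) : ~~ pentagon a b c d e by exact: npent (a, b, c, d, e).
  have colM : colorable_in (~: (v |: nbrs v)) w.+2.
    apply: nonnbrs_colorable => //; last exact: omega_sub (subsetT _) om.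
    move=> D D0 sD; apply: (no_cutset D v) => //.
    rewrite in_setU negb_or; apply/andP; split.
      by apply/negP => /(subsetP sD); rewrite !inE eqxx.
    apply/negP => /boundaryP[_ [y /(subsetP sD)]].
    by rewrite !inE negb_or => /andP[_ /negP].
  have colN : colorable_in (nbrs v) (chi_bound w.+1).
    apply: IH; last by apply: omega_nbrs om.
    by rewrite properT; apply/negP => /eqP/setP/(_ v); rewrite !inE adj_irr.
  apply: colorable_in_le (chi_boundS w) _.
  (* [v] takes a colour from the palette of its nonneighbours. *)
  have cover : [set: G] \subset nbrs v :|: (v |: ~: (v |: nbrs v)).
    by apply/subsetP => x _; rewrite !inE; case: (x == v); case: (adj v x).
  apply: (colorable_in_sub cover); apply: colorable_inU => //.
  apply: colorable_add => // x; rewrite !inE negb_or; by case/andP.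
- have := om [set v] (subsetT _); rewrite cards1; case/(_ _)/negP => //.
  exact: clique1.
- exact: omega1_colorable.
Qed.

(** [chi_bound_step] colours whole graphs, so it is applied to [induced A]; clique bounds and
    colourings travel through [val], and the induction is on [#|A|]. *)
Lemma chi_bound_induced (G : sgraph) (A : {set G}) w :
  no_P5 G -> no_K23 G -> omega_le A w -> colorable_in A (chi_bound w).
Proof.
move=> hP hK; have [n] := ubnP #|A|; elim: n A w => // n IH A w leAn om.
pose H := induced A.
have transfer (B : {set H}) w' : omega_le [set val x | x in B] w' -> omega_le B w'.
  move=> h K sKB cK; rewrite -(card_imset _ val_inj); apply: h.
    exact: imsetS.
  apply/cliqueP => _ _ /imsetP[x xK ->] /imsetP[y yK ->] xy.
  by move/cliqueP: cK; apply=> //; apply: contraNneq xy => ->.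
have transfer' (B : {set H}) w' : omega_le B w' -> omega_le [set val x | x in B] w'.
  move=> h K sKB cK.
  have -> : K = [set val x | x in [set x : H | val x \in K]].
    apply/setP => x; apply/idP/imsetP => [xK|[y + ->]]; last by rewrite inE.
    by have /imsetP[y yB E] := subsetP sKB x xK; exists y; rewrite // inE -E.
  rewrite card_imset; last exact: val_inj.
  apply: h.
    apply/subsetP => x; rewrite inE => /(subsetP sKB)/imsetP[y yB /val_inj E].
    by rewrite E.
  by apply/cliqueP => x y; rewrite !inE => xK yK xy; move/cliqueP: cK; apply.
have [] := @chi_bound_step H w.
- by move=> a b c d e; apply: hP.
- move=> a b ab nab x y z; rewrite !inE => xA yA zA xy xz yz.
  by apply: (hK (val a) (val b)); rewrite // !inE.
- move=> B w' pB omB.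
  have [||c cb cp] := IH [set val x | x in B] w'.
  + rewrite card_imset; last exact: val_inj.
    apply: leq_trans (_ : #|[set: H]| <= n); first exact: proper_card.
    by rewrite cardsT card_sig -ltnS.
  + exact: transfer'.
  exists (fun x => c (val x)) => [x xB|x y xB yB]; first by apply/cb/imset_f.
  by apply: cp; apply: imset_f.
- apply: transfer; apply: omega_sub om; apply/subsetP => _ /imsetP[x _ ->].
  exact: valP.
(* Vertices outside [A] get the dummy colour [0]. *)
move=> c cb cp; exists (fun x => oapp c 0 (insub x : option H)).
  by move=> x xA; rewrite insubT /= cb.
move=> x y xA yA xy; rewrite !insubT /=; exact: cp.
Qed.

(** * From forbidden induced subgraphs to adjacency patterns *)

Lemma induced_embedding (G H : sgraph) (g : H -> G) : injective g ->
  (forall i j, adj (g i) (g j) = adj i j) -> ~ induced_free H G.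
Proof.
move=> gi gadj; apply; exists [set g i | i : H].
set A := [set g i | i : H].
have gA i : g i \in A by apply/imsetP; exists i.
pose h i : induced A := exist _ (g i) (gA i).
have hi : injective h by move=> i j [] /gi.
have [f fK hK] : bijective h.
  by apply: inj_card_bij => //; rewrite card_sig card_imset.
exists f; split; first by exists h.
by move=> x y; rewrite -[in RHS](hK x) -[in RHS](hK y) -gadj.
Qed.

Lemma P5_free_no_P5 (G : sgraph) : induced_free (path_graph 5) G -> no_P5 G.
Proof.
move=> free a b c d e ab bc cd de ac ad ae bd be ce.
pose g (i : path_graph 5) := tnth [tuple a; b; c; d; e] i.
have gadj (i j : path_graph 5) : adj (g i) (g j) = adj i j.
  case: i => [[|[|[|[|[|i]]]]] //= hi]; case: j => [[|[|[|[|[|j]]]]] //= hj];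
  rewrite /g !(tnth_nth a) /= ?adj_irr //;
  solve [adj_solve | apply/negbTE; adj_solve].
apply: (@induced_embedding G (path_graph 5) g) free => // i j E.
(* Injectivity of [g]: distinct vertices of the path on five vertices have distinct
   neighbourhoods. *)
have : forall k : path_graph 5, adj i k = adj j k by move=> k; rewrite -!gadj E.
move=> h.
have := h (@Ordinal 5 0 isT); have := h (@Ordinal 5 1 isT).
have := h (@Ordinal 5 2 isT); have := h (@Ordinal 5 3 isT).
have := h (@Ordinal 5 4 isT); move: i j {E h}.
case=> [[|[|[|[|[|i]]]]] //= hi]; case=> [[|[|[|[|[|j]]]]] //= hj] //=;
  by move=> *; apply: val_inj.
Qed.

Lemma K23_free_no_K23 (G : sgraph) :
  induced_free (complete_bipartite 2 3) G -> no_K23 G.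
Proof.
move=> free a b ab nab x y z; rewrite !inE.
move=> /andP[ax bx] /andP[ay bY] /andP[az bz] xy xz yz.
apply: contraT; rewrite !negb_or => /and3P[nxy nxz nyz]; exfalso.
pose g (i : complete_bipartite 2 3) := match i with
  | inl i => tnth [tuple a; b] i | inr i => tnth [tuple x; y; z] i end.
have gadj (i j : complete_bipartite 2 3) : adj (g i) (g j) = adj i j.
  case: i => [] [[|[|[|i]]] //= hi]; case: j => [] [[|[|[|j]]] //= hj];
  rewrite !(tnth_nth a) /= ?adj_irr //;
  solve [adj_solve | apply/negbTE; adj_solve].
apply: (@induced_embedding G (complete_bipartite 2 3) g) free => // i j E.
(* Vertices in one part have equal neighbourhoods, so here injectivity within a part comes from the
   assumed distinctness. *)
have : uniq [tuple a; b] by rewrite /= inE ab.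
have : uniq [tuple x; y; z] by rewrite /= !inE negb_or xy xz yz.
move=> /tuple_uniqP u3 /tuple_uniqP u2.
case: i j E => i [] j E.
- by congr inl; apply: u2.
- by have := gadj (inl i) (inr j); rewrite E adj_irr.
- by have := gadj (inr i) (inl j); rewrite E adj_irr.
- by congr inr; apply: u3.
Qed.

Theorem theorem1p2 (G : sgraph) (Gconn : connected G)
    (omega_ge2 : 2 <= clique_number G)
    (P5_free : induced_free (path_graph 5) G)
    (K23_free : induced_free (complete_bipartite 2 3) G) :
  chromatic_number G <= 2 * clique_number G ^ 2 - clique_number G - 3.
Proof.
have [||K _ cK|c cb cp] := @chi_bound_induced G [set: G] (clique_number G).
- exact: P5_free_no_P5.
- exact: K23_free_no_K23.
- exact: leq_bigmax_cond.
rewrite /chi_bound leqNgt omega_ge2 /= in cb.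
rewrite /chromatic_number; case: ex_minnP => m _; apply.
apply/existsP; exists [ffun x => Ordinal (cb x (in_setT x))].
apply/forallP => x; apply/forallP => y; apply/implyP => xy; rewrite !ffunE.
by rewrite -val_eqE /=; apply: cp.
Qed.
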